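(* Let $p$ be a prime, let $F=\langle x,y\rangle$ be the free group on two generators, and let $n\geq 1$ be an integer. Then the $p$-central quotient $F/\lambda_n(F)$ is a Beauville group if and only if $p\geq 5$ and $n\geq 2$.
   Context: For a group $G$ and a prime $p$, the $p$-central series of $G$ is the series $G=\lambda_1(G)\geq \lambda_2(G)\geq\cdots$ defined by $\lambda_n(G)=[\lambda_{n-1}(G),G]\,\lambda_{n-1}(G)^p$ for $n>1$, where $H^p$ denotes the subgroup generated by all $p$-th powers of elements of $H$. The quotients $G/\lambda_n(G)$ are called the $p$-central quotients of $G$. For elements $x,y$ of a finite group $G$ put $$\Sigma(x,y)=\bigcup_{g\in G}\Big(\langle x\rangle^g\cup\langle y\rangle^g\cup\langle xy\rangle^g\Big),$$ where $H^g$ denotes the conjugate of $H$ by $g$. A finite group $G$ is a Beauville group if $G$ is a 2-generator group (i.e. its minimal number of generators is 2; in particular the trivial group is not a Beauville group) and there exist two generating sets $\{x_1,y_1\}$ and $\{x_2,y_2\}$ of $G$ such that $\Sigma(x_1,y_1)\cap\Sigma(x_2,y_2)=1$. *)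

(* Defs.v *)
From HB Require Import structures.
From mathcomp Require Import all_boot.
From mathcomp Require Import boolp classical_sets cardinality.

Set Implicit Arguments.
Unset Strict Implicit.
Unset Printing Implicit Defensive.

Local Open Scope quotient_scope.
Local Open Scope classical_set_scope.
Local Open Scope group_scope.

(* The groups below may be infinite, so subgroups of [G : groupType] are
   represented by classical sets rather than by [{group gT}]. *)

Definition is_subgroup (G : groupType) (H : set G) : Prop :=
  [/\ H 1, forall x y, H x -> H y -> H (x * y) & forall x, H x -> H x^-1].

Definition is_normal (G : groupType) (H : set G) : Prop :=
  is_subgroup H /\ forall x g, H x -> H (x ^ g).

Definition gen (G : groupType) (A : set G) : set G := smallest (@is_subgroup G) A.

Definition set_mul (G : groupType) (A B : set G) : set G :=
  [set x * y | x in A & y in B].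

Definition set_conj (G : groupType) (A : set G) (g : G) : set G :=
  [set x ^ g | x in A].

Definition commutator_subgroup (G : groupType) (H K : set G) : set G :=
  gen [set [~ h, k] | h in H & k in K].

Definition power_subgroup (G : groupType) (p : nat) (H : set G) : set G :=
  gen [set h ^+ p | h in H].

(* The p-central series.  It starts at index 1; the value at index 0 is the junk value [setT]. *)
Definition lambda (G : groupType) (p n : nat) : set G :=
  iter n.-1
    (fun H => set_mul (commutator_subgroup H [set: G]) (power_subgroup p H))
    [set: G].
Arguments lambda : clear implicits.

Section GenTheory.
Variable G : groupType.
Implicit Types (A H K : set G).

Lemma gen_subgroup A : is_subgroup (gen A).
Proof.
split=> [M [[] //]|x y xA yA M MA|x xA M MA].
  by have [[_ MM _] _] := MA; apply: MM; [apply: xA|apply: yA].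
by have [[_ _ MV] _] := MA; apply: MV; apply: xA.
Qed.

Lemma gen_sub A : A `<=` gen A.
Proof. by move=> x Ax M [_]; apply. Qed.

Lemma gen_min A H : is_subgroup H -> A `<=` H -> gen A `<=` H.
Proof. by move=> sH AH x; apply. Qed.

Lemma gen_normal A : (forall x g, A x -> A (x ^ g)) -> is_normal (gen A).
Proof.
move=> nA; split=> [|x g]; first exact: gen_subgroup.
have [g1 gM gV] := gen_subgroup A.
apply: (@gen_min A [set x | gen A (x ^ g)]) => [|y Ay]; last first.
  by apply: gen_sub; apply: nA.
by split=> [|y z|y] /=; rewrite ?conj1g // ?conjMg ?conjVg; [apply: gM|apply: gV].
Qed.

Lemma set_mul_normal H K : is_normal H -> is_normal K -> is_normal (set_mul H K).
Proof.
move=> [[H1 HM HV] HJ] [[K1 KM KV] KJ]; split; first split.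
- by exists 1 => //; exists 1 => //; rewrite mulg1.
- move=> _ _ [h Hh [k Kk <-]] [h' Hh' [k' Kk' <-]].
  exists (h * h'); first exact: HM.
  exists (k ^ h' * k'); first by apply: KM => //; apply: KJ.
  by rewrite conjgE !mulgA; congr (_ * _ * _); rewrite mulgK.
- move=> _ [h Hh [k Kk <-]]; exists (h^-1); first exact: HV.
  exists (k^-1 ^ h^-1); first by apply: KJ; apply: KV.
  by rewrite conjgE invgK !mulgA mulVg mul1g invgM.
- move=> _ g [h Hh [k Kk <-]]; exists (h ^ g); first exact: HJ.
  by exists (k ^ g); [exact: KJ|rewrite conjMg].
Qed.

Lemma lambda_normal p n : is_normal (lambda G p n).
Proof.
rewrite /lambda; elim: n.-1 => [|m [_ IH]] /=; first by [].
apply: set_mul_normal; apply: gen_normal.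
  move=> _ g [h Hh [k _ <-]]; exists (h ^ g); first exact: IH.
  by exists (k ^ g) => //; rewrite -conjRg.
by move=> _ g [h Hh <-]; exists (h ^ g); [exact: IH|rewrite conjXg].
Qed.

End GenTheory.

Record normalSubgroup (G : groupType) := NormalSubgroup {
  nsg_set : set G;
  nsg_normal : is_normal nsg_set
}.

Definition lambda_nsg (G : groupType) (p n : nat) : normalSubgroup G :=
  NormalSubgroup (lambda_normal G p n).

Section Quotient.
Variables (G : groupType) (N : normalSubgroup G).

Definition nsg_rel : rel G := fun x y => `[< nsg_set N (x^-1 * y) >].

Lemma nsg_rel_refl : reflexive nsg_rel.
Proof. by move=> x; apply/asboolP; rewrite mulVg; have [[]] := nsg_normal N. Qed.

Lemma nsg_rel_sym : symmetric nsg_rel.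
Proof.
have [[_ _ NV] _] := nsg_normal N.
have s x y : nsg_rel x y -> nsg_rel y x.
  by move=> /asboolP/NV; rewrite invgM invgK => h; apply/asboolP.
by move=> x y; apply/idP/idP; apply: s.
Qed.

Lemma nsg_rel_trans : transitive nsg_rel.
Proof.
have [[_ NM _] _] := nsg_normal N.
move=> y x z /asboolP xy /asboolP yz; apply/asboolP.
by have := NM _ _ xy yz; rewrite mulgA mulgK.
Qed.

Canonical nsg_equiv := EquivRel nsg_rel nsg_rel_refl nsg_rel_sym nsg_rel_trans.

Definition quotient : Type := {eq_quot nsg_equiv}.
HB.instance Definition _ := Choice.on quotient.
HB.instance Definition _ := Quotient.on quotient.
HB.instance Definition _ := EqQuotient.on quotient.

Definition quotient_mul (a b : quotient) : quotient := \pi_quotient (repr a * repr b).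
Definition quotient_one : quotient := \pi_quotient 1.
Definition quotient_inv (a : quotient) : quotient := \pi_quotient (repr a)^-1.

Lemma quotient_piP (x y : G) :
  \pi_quotient x = \pi_quotient y <-> nsg_set N (x^-1 * y).
Proof. by split=> [/eqmodP/asboolP|h]; [|apply/eqmodP/asboolP]. Qed.

Lemma quotient_piM (x y : G) :
  quotient_mul (\pi_quotient x) (\pi_quotient y) = \pi_quotient (x * y).
Proof.
have [[_ NM NV] NJ] := nsg_normal N; apply/quotient_piP.
case: piP => x' /quotient_piP/NV; rewrite invgM invgK => Nx.
case: piP => y' /quotient_piP/NV; rewrite invgM invgK => Ny.
have -> : (x' * y')^-1 * (x * y) = (x'^-1 * x) ^ y' * (y'^-1 * y).
  by rewrite conjgE invgM !mulgA mulgK.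
by apply: NM => //; apply: NJ.
Qed.

Lemma quotient_piV (x : G) :
  quotient_inv (\pi_quotient x) = \pi_quotient x^-1.
Proof.
have [_ NJ] := nsg_normal N; apply/quotient_piP.
case: piP => x' /quotient_piP Nx.
by have := NJ _ (x'^-1) Nx; rewrite conjgE !invgK !mulgA mulgK.
Qed.

Lemma quotient_mulA : associative quotient_mul.
Proof.
move=> a b c; rewrite -[a]reprK -[b]reprK -[c]reprK.
move: (repr a) (repr b) (repr c) => x y z.
by rewrite (quotient_piM y z) (quotient_piM x y) !quotient_piM mulgA.
Qed.

Lemma quotient_mul1 : left_id quotient_one quotient_mul.
Proof. by move=> a; rewrite -[a]reprK quotient_piM mul1g. Qed.

Lemma quotient_mulr1 : right_id quotient_one quotient_mul.
Proof. by move=> a; rewrite -[a]reprK quotient_piM mulg1. Qed.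

Lemma quotient_mulV : left_inverse quotient_one quotient_inv quotient_mul.
Proof. by move=> a; rewrite -[a]reprK quotient_piV quotient_piM mulVg. Qed.

Lemma quotient_mulrV : right_inverse quotient_one quotient_inv quotient_mul.
Proof. by move=> a; rewrite -[a]reprK quotient_piV quotient_piM mulgV. Qed.

HB.instance Definition _ := isGroup.Build quotient
  quotient_mulA quotient_mul1 quotient_mulr1 quotient_mulV quotient_mulrV.

End Quotient.

Section FreeGroup.
Variable T : choiceType.

(* [(t, false)] stands for the generator t and [(t, true)] for its inverse. *)
Definition letter : Type := (T * bool)%type.
HB.instance Definition _ := Choice.on letter.

Definition letter_inv (a : letter) : letter := (a.1, ~~ a.2).

Definition reduced (w : seq letter) : bool :=
  sorted (fun a b => b != letter_inv a) w.

Record freeGroup := FreeGroup {word :> seq letter; _ : reduced word}.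
HB.instance Definition _ := [isSub for word].
HB.instance Definition _ := [Choice of freeGroup by <:].

Definition push (a : letter) (w : seq letter) : seq letter :=
  if w is b :: w' then if b == letter_inv a then w' else a :: w else [:: a].

Arguments letter_inv : simpl never.

Definition word_mul (u v : seq letter) : seq letter := foldr push v u.
Definition word_inv (u : seq letter) : seq letter := rev (map letter_inv u).

Lemma letter_invK : involutive letter_inv.
Proof. by case=> t b; rewrite /letter_inv /= negbK. Qed.

Lemma push_reduced a w : reduced w -> reduced (push a w).
Proof.
case: w => [|b w] //= rw; case: ifP => [_|/negbT ab]; first exact: path_sorted rw.
by rewrite /= ab.
Qed.

Lemma word_mul_reduced u v : reduced v -> reduced (word_mul u v).
Proof. by move=> rv; elim: u => //= a u; apply: push_reduced. Qed.

Lemma word_inv_reduced u : reduced u -> reduced (word_inv u).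
Proof.
rewrite /reduced /word_inv rev_sorted sorted_map; apply: sub_sorted => a b.
by rewrite /= letter_invK eq_sym.
Qed.

Lemma pushK a w : reduced w -> push (letter_inv a) (push a w) = w.
Proof.
case: w => [|b w] /=; first by rewrite letter_invK eqxx.
case: eqP => [->|_ _]; last by rewrite /= letter_invK eqxx.
by case: w => [|c w] //= /andP[/negbTE->].
Qed.

Lemma push_invK a w : reduced w -> push a (push (letter_inv a) w) = w.
Proof. by move=> rw; rewrite -{1}[a]letter_invK pushK. Qed.

Lemma word_mul_push a u v :
  reduced v -> word_mul (push a u) v = push a (word_mul u v).
Proof.
move=> rv; case: u => [|b u] //=; case: eqP => [->|//].
by rewrite push_invK // word_mul_reduced.
Qed.

Lemma word_mulA u v w :
  reduced w -> word_mul u (word_mul v w) = word_mul (word_mul u v) w.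
Proof. by move=> rw; elim: u => //= a u ->; rewrite word_mul_push. Qed.

Lemma word_mul1 u : reduced u -> word_mul u [::] = u.
Proof.
elim: u => //= a u IH au.
have ru : reduced u := path_sorted au.
rewrite (IH ru) {IH ru}.
by case: u au => [|b u] //= /andP[/negbTE->].
Qed.

Lemma word_mulKl u v : reduced v -> word_mul (word_inv u) (word_mul u v) = v.
Proof.
elim: u => //= a u IH rv.
rewrite {1}/word_mul /word_inv /= rev_cons -cats1 foldr_cat /=.
by rewrite pushK ?word_mul_reduced //; apply: IH.
Qed.

Lemma word_mulV u : reduced u -> word_mul (word_inv u) u = [::].
Proof. by move=> ru; rewrite -{2}(word_mul1 ru) word_mulKl. Qed.

Lemma word_invK : involutive word_inv.
Proof.
by move=> u; rewrite /word_inv map_rev revK mapK //; apply: letter_invK.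
Qed.

Definition fg_mul (u v : freeGroup) : freeGroup :=
  FreeGroup (word_mul_reduced u (valP v)).
Definition fg_one : freeGroup := @FreeGroup [::] isT.
Definition fg_inv (u : freeGroup) : freeGroup := FreeGroup (word_inv_reduced (valP u)).

Lemma fg_mulA : associative fg_mul.
Proof. by move=> u v w; apply: val_inj; apply: word_mulA; apply: valP. Qed.

Lemma fg_mul1 : left_id fg_one fg_mul.
Proof. by move=> u; apply: val_inj. Qed.

Lemma fg_mulr1 : right_id fg_one fg_mul.
Proof. by move=> u; apply: val_inj; apply: word_mul1; apply: valP. Qed.

Lemma fg_mulV : left_inverse fg_one fg_inv fg_mul.
Proof. by move=> u; apply: val_inj; apply: word_mulV; apply: valP. Qed.

Lemma fg_mulrV : right_inverse fg_one fg_inv fg_mul.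
Proof.
move=> u; apply: val_inj => /=; rewrite -{1}[word u]word_invK.
by apply: word_mulV; apply: word_inv_reduced; apply: valP.
Qed.

HB.instance Definition _ := isGroup.Build freeGroup
  fg_mulA fg_mul1 fg_mulr1 fg_mulV fg_mulrV.

Definition fg_gen (t : T) : freeGroup := @FreeGroup [:: (t, false)] isT.

Lemma fg_universal (H : groupType) (f : T -> H) :
  exists! phi : freeGroup -> H,
    {morph phi : u v / u * v} /\ forall t, phi (fg_gen t) = f t.
Proof.
pose ev (a : letter) := if a.2 then (f a.1)^-1 else f a.1.
pose phi (w : seq letter) := foldr (fun a h => ev a * h) 1 w.
have evV a : ev (letter_inv a) = (ev a)^-1.
  by case: a => t [] //=; rewrite /ev /= invgK.
have phi_push a w : phi (push a w) = ev a * phi w.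
  case: w => [|b w] //=; case: eqP => [->|//] /=.
  by rewrite evV mulgA mulgV mul1g.
exists (fun w : freeGroup => phi w); split.
  split=> [u v|t] /=; last by rewrite /phi /= mulg1.
  change (phi (word_mul u v) = phi u * phi v).
  elim: (word u) => [|a w IH] /=; first by rewrite mul1g.
  by rewrite phi_push IH mulgA.
move=> psi [psiM psiT]; apply/funext => -[w rw].
have psi1 : psi 1 = 1 by apply: (mulgI (psi 1)); rewrite -psiM !mulg1.
have psiV u : psi u^-1 = (psi u)^-1.
  by apply: (mulgI (psi u)); rewrite -psiM !mulgV.
have psi_letter a (ra : reduced [:: a]) : psi (FreeGroup ra) = ev a.
  case: a ra => t [] ra; rewrite /ev /= -psiT -?psiV; congr psi; exact: val_inj.
elim: w rw => [|a w IH] rw.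
  by rewrite (_ : FreeGroup rw = 1) ?psi1 //; apply: val_inj.
have rw' : reduced w := path_sorted rw.
have /= IHw := IH rw'.
change (ev a * phi w = psi (FreeGroup rw)).
rewrite IHw -(psi_letter a isT) -psiM; congr psi.
apply: val_inj => /=.
by case: w rw {IH IHw rw'} => [|b w] //= /andP[/negbTE->].
Qed.

End FreeGroup.

Definition free2 : groupType := freeGroup 'I_2.

(* The minimal number of generators of G is d. *)
Definition min_generators (G : groupType) (d : nat) : Prop :=
  (exists s : seq G, size s = d /\ gen [set` s] = [set: G]) /\
  (forall s : seq G, gen [set` s] = [set: G] -> (d <= size s)%N).

Definition Sigma (G : groupType) (x y : G) : set G :=
  \bigcup_g (set_conj (gen [set x]) g `|` set_conj (gen [set y]) g
             `|` set_conj (gen [set x * y]) g).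

(* Finiteness is a conjunct because [quotient N] is only known to be a
   [groupType]. *)
Definition Beauville (G : groupType) : Prop :=
  [/\ finite_set [set: G],
      min_generators G 2 &
      exists x1 y1 x2 y2 : G,
        [/\ gen [set x1; y1] = [set: G],
            gen [set x2; y2] = [set: G] &
            Sigma x1 y1 `&` Sigma x2 y2 = [set 1]]].

(* Main.v *)
Require Import Defs.
From HB Require Import structures.
From mathcomp Require Import all_boot all_algebra zify ring.
From mathcomp Require Import boolp classical_sets cardinality.

(** Write F for the free group on x, y.  An element outside [lambda_2] has an exponent sum
prime to p, so every such element of G = F/[lambda_n] generates a cyclic group of order
[p^(n-1)] that embeds into the abelianization [(Z/p^(n-1))^2].  If [p >= 5], generating
pairs of G whose six relevant images have distinct slopes modulo p therefore give disjoint
sets [Sigma].  Conversely, if [p <= 3] the projective line over [F_p] is too small, so two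
elements a, b taken from the two triples satisfy [a = b^i] modulo [lambda_2].  Raising to the
p-th power carries congruences modulo [lambda_k] to congruences modulo [lambda_(k+1)], so
[a^(p^(n-2)) = b^(i p^(n-2))] in G, and this common element is nontrivial. *)

Set Implicit Arguments.
Unset Strict Implicit.
Unset Printing Implicit Defensive.

Import GRing.Theory.

Section Lemmas.

Local Open Scope quotient_scope.
Local Open Scope classical_set_scope.
Local Open Scope group_scope.

Lemma set_seq2 (T : eqType) (a b : T) : [set` [:: a; b]] = [set a; b].
Proof.
apply/seteqP; split=> c /=; rewrite !inE.
  by move=> /orP[]/eqP->; [left|right].
by move=> [->|->]; rewrite eqxx ?orbT.
Qed.

(** * Generated subgroups and the sets [Sigma] *)

Section Subgroups.
Variable G : groupType.
Implicit Types (A B H : set G) (x y g : G).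

Lemma gen_subset A B : A `<=` B -> gen A `<=` gen B.
Proof.
by move=> AB; apply: gen_min; [exact: gen_subgroup | move=> x /AB/gen_sub].
Qed.

Lemma genX A x n : gen A x -> gen A (x ^+ n).
Proof.
have [g1 gM _] := gen_subgroup A.
by move=> Ax; elim: n => [|n IH]; rewrite ?expg0 // expgS; apply: gM.
Qed.

(** Since [x ^+ m = 1], the inverse of [x ^+ i] is [x ^+ (i * m.-1)], so natural exponents already
    give a subgroup. *)
Lemma mem_gen1 x m y : 0 < m -> x ^+ m = 1 -> gen [set x] y ->
  exists i, y = x ^+ i.
Proof.
move=> m0 xm; apply: (@gen_min _ _ [set y | exists i, y = x ^+ i]); last first.
  by move=> _ ->; exists 1%N; rewrite expg1.
split=> [|_ _ [i ->] [j ->]|_ [i ->]] /=; first by exists 0%N; rewrite expg0.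
  by exists (i + j)%N; rewrite expgnDr.
exists (i * m.-1)%N; apply: (mulgI (x ^+ i)).
rewrite mulgV -expgnDr -mulnS prednK //.
by rewrite mulnC expgnA xm expg1n.
Qed.

Lemma SigmaP x y g : Sigma x y g <->
  exists a h z, [/\ a = x \/ a = y \/ a = x * y, gen [set a] z & g = z ^ h].
Proof.
split=> [[h _ [[]|] [z xz <-]]|[a [h [z [a_eq az ->]]]]].
- by exists x, h, z; split=> //; left.
- by exists y, h, z; split=> //; right; left.
- by exists (x * y), h, z; split=> //; right; right.
- by exists h => //; case: a_eq az => [->|[->|->]] az;
    [left; left | left; right | right]; exists z.
Qed.

Lemma Sigma1 x y : Sigma x y 1.
Proof.
apply/SigmaP; exists x, 1, 1; rewrite conj1g; split; [by left| |by []].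
by case: (gen_subgroup [set x]).
Qed.

End Subgroups.

(** * The projection onto a quotient as a homomorphism *)

Section QuotientMap.
Variables (G : groupType) (N : normalSubgroup G).

Definition qpi (x : G) : quotient N := \pi_(quotient N) x.

Lemma qpi_surj a : exists x, a = qpi x.
Proof. by exists (repr a); rewrite /qpi reprK. Qed.

Lemma qpiM : {morph qpi : x y / x * y}.
Proof. by move=> x y; rewrite /qpi -quotient_piM. Qed.

Lemma qpi1 : qpi 1 = 1.
Proof. by []. Qed.

Lemma qpiV : {morph qpi : x / x^-1}.
Proof. by move=> x; rewrite /qpi -quotient_piV. Qed.

Lemma qpiX n : {morph qpi : x / x ^+ n}.
Proof. by move=> x; elim: n => [|n IH]; rewrite ?qpi1 // !expgS qpiM IH. Qed.

Lemma qpiJ : {morph qpi : x y / x ^ y}.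
Proof. by move=> x y; rewrite !conjgE !qpiM qpiV. Qed.

Lemma qpiR : {morph qpi : x y / [~ x, y]}.
Proof. by move=> x y; rewrite !commgEl qpiM qpiV qpiJ. Qed.

Lemma eq_qpi x y : qpi x = qpi y <-> nsg_set N (x^-1 * y).
Proof. exact: quotient_piP. Qed.

Lemma qpi_eq1 x : qpi x = 1 <-> nsg_set N x.
Proof.
by split=> [/esym|h]; [rewrite -qpi1 => /eq_qpi|apply/esym/eq_qpi];
  rewrite invg1 mul1g.
Qed.

Lemma gen_qpi (A : set G) :
  gen A = [set: G] -> gen (qpi @` A) = [set: quotient N].
Proof.
move=> genA; apply/seteqP; split=> // a _; have [x ->] := qpi_surj a.
have [g1 gM gV] := gen_subgroup (qpi @` A).
have: gen A x by rewrite genA.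
apply: (@gen_min _ _ [set x | gen (qpi @` A) (qpi x)]) => [|y Ay] /=.
  by split=> [|y z|y] /=; rewrite ?qpi1 // ?qpiM ?qpiV; [exact: gM|exact: gV].
by apply: gen_sub; exists y.
Qed.

End QuotientMap.

(** * Commutators, powers and congruences along the p-central series *)

Section PCentralSeries.
Variables (G : groupType) (p : nat).
Implicit Types (x y g : G) (k : nat).
Local Notation L := (lambda G p).

Lemma lambdaR k x g : L k.+1 x -> L k.+2 [~ x, g].
Proof.
move=> Lx; exists [~ x, g]; first by apply: gen_sub; exists x => //; exists g.
by exists 1; [case: (gen_subgroup [set h ^+ p | h in L k.+1])|rewrite mulg1].
Qed.

Lemma lambdaX k x : L k.+1 x -> L k.+2 (x ^+ p).
Proof.
move=> Lx; exists 1; last first.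
  by exists (x ^+ p); [apply: gen_sub; exists x|rewrite mul1g].
by case: (gen_subgroup [set [~ h, g] | h in L k.+1 & g in [set: G]]).
Qed.

Lemma lambdaXX k m x : L k.+1 x -> L (m + k).+1 (x ^+ (p ^ m)).
Proof.
by move=> Lx; elim: m => [|m IH]; rewrite ?expg1 // expnSr expgnA; apply: lambdaX.
Qed.

Lemma lambda_min k (H : set G) : is_subgroup H ->
  (forall x g, L k.+1 x -> H [~ x, g]) -> (forall x, L k.+1 x -> H (x ^+ p)) ->
  L k.+2 `<=` H.
Proof.
move=> sH HR HX _ [x Rx [y Xy <-]]; have [_ HM _] := sH.
apply: HM; [apply: gen_min Rx => // _ [h Lh [g _ <-]]; exact: HR|].
by apply: gen_min Xy => // _ [h Lh <-]; exact: HX.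
Qed.

(* Modulo [lambda k.+2] the difference of [x] and [y] is central of exponent [p]. *)
Lemma lambda_congX k x y :
  L k.+1 (x^-1 * y) -> L k.+2 ((x ^+ p)^-1 * y ^+ p).
Proof.
set c := x^-1 * y => Lc; have -> : y = x * c by rewrite /c mulVKg.
apply/(eq_qpi (lambda_nsg G p k.+2)); rewrite !qpiX qpiM expgMn.
  by rewrite -!qpiX [qpi _ (c ^+ p)](qpi_eq1 _ _).2 ?mulg1 //; exact: lambdaX.
by apply/commute_sym/commgP/eqP; rewrite -qpiR; apply/qpi_eq1/lambdaR.
Qed.

Lemma lambda_congXX k m x y :
  L k.+1 (x^-1 * y) -> L (m + k).+1 ((x ^+ (p ^ m))^-1 * y ^+ (p ^ m)).
Proof.
move=> Lxy; elim: m => [|m IH]; first by rewrite expn0 !expg1.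
by rewrite expnSr !expgnA addSn; apply: lambda_congX.
Qed.

End PCentralSeries.

(** * Finiteness of the p-central quotients *)

Section CentralSpan.
Variables (G : groupType) (p : nat).
Hypothesis p_gt0 : 0 < p.

(** When the elements of [C] are central of exponent [p], this lists the subgroup that they
    generate, possibly with repetitions. *)
Fixpoint pspan (C : seq G) : seq G :=
  if C is c :: C' then [seq c ^+ i * w | i <- iota 0 p, w <- pspan C']
  else [:: 1].

Lemma pspanM C : (forall c, c \in C -> c ^+ p = 1 /\ forall g, commute c g) ->
  forall c w, c \in C -> w \in pspan C -> c * w \in pspan C.
Proof.
elim: C => [|d C IH] // HC c _ + /allpairsP[[i w] [/= Hi Hw ->]].
rewrite inE => /orP[/eqP->|cC].
  apply/allpairsP; exists (i.+1 %% p, w)%N; split=> //=.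
    by rewrite mem_iota /= ltn_pmod.
  rewrite mulgA -expgS {1}(divn_eq i.+1 p) expgnDr mulnC expgnA.
  by have [-> _] := HC d (mem_head _ _); rewrite expg1n mul1g.
apply/allpairsP; exists (i, c * w); split=> //=.
  by apply: IH => // e eC; apply: HC; rewrite inE eC orbT.
have [_ cc] := HC c (mem_behead (s := d :: C) cC).
by rewrite !mulgA cc.
Qed.

Lemma pspan1 C : 1 \in pspan C.
Proof.
elim: C => [|c C IH]; first exact: mem_head.
apply/allpairsP; exists (0%N, 1); split=> //=; first by rewrite mem_iota.
by rewrite expg0 mulg1.
Qed.

End CentralSpan.

(* Schreier: if [T] represents the cosets of [lambda k.+1], then each product [t * a] with
   [t] in [T] and [a] a generator or an inverse of one is some [t'] in [T] times an element
   of a finite subset [C] of [lambda k.+1], and [lambda k.+1] is central of exponent [p]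
   modulo [lambda k.+2]. *)
Lemma lambda_finite (G : groupType) (s : seq G) (p k : nat) :
  0 < p -> gen [set` s] = [set: G] ->
  finite_set [set: quotient (lambda_nsg G p k.+1)].
Proof.
move=> p_gt0 gens; elim: k => [|k IH].
  apply/finite_seqP; exists [:: 1]; apply/seteqP; split=> a //= _.
  by have [x ->] := qpi_surj a; rewrite inE; apply/eqP/qpi_eq1.
have [T0 T0E] := (finite_seqP _).1 IH; pose T := map repr T0.
have TP g : exists2 t, t \in T & lambda G p k.+1 (t^-1 * g).
  exists (repr (qpi (lambda_nsg G p k.+1) g)).
    apply: map_f; suff: [set: quotient (lambda_nsg G p k.+1)] (qpi _ g).
      by rewrite T0E.
    by [].
  by apply/(eq_qpi (lambda_nsg G p k.+1)); rewrite /qpi reprK.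
pose pi := qpi (lambda_nsg G p k.+2).
pose S := s ++ map (fun g => g^-1) s.
pose C := [seq c <- [seq t'^-1 * ta | t' <- T, ta <- [seq t * a | t <- T, a <- S]]
             | `[< lambda G p k.+1 c >]].
pose P := pspan p (map pi C).
pose K := [seq pi t * w | t <- T, w <- P].
have KM l a : l \in K -> a \in S -> l * pi a \in K.
  move=> /allpairsP[[t w] [/= tT wP ->]] aS.
  have [t' t'T Lc] := TP (t * a).
  pose c := t'^-1 * (t * a).
  have cC : c \in C.
    rewrite mem_filter; apply/andP; split; first exact/asboolP.
    apply/allpairsP; exists (t', t * a); split=> //.
    by apply/allpairsP; exists (t, a).
  have Ccent d : d \in map pi C -> d ^+ p = 1 /\ forall g, commute d g.
    move=> /mapP[e]; rewrite mem_filter => /andP[/asboolP Le _] ->; split.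
      by rewrite -qpiX; apply/qpi_eq1/lambdaX.
    move=> g; have [x ->] := qpi_surj g.
    by apply/commgP/eqP; rewrite -qpiR; apply/qpi_eq1/lambdaR.
  have wcomm g : commute w g.
    have: w \in pspan p (map pi C) by [].
    elim: (map pi C) w {wP} Ccent => [|d D IHD] w Ccent /=.
      by rewrite inE => /eqP->; apply/commute_sym/commute1.
    move=> /allpairsP[[i v] [/= _ vD ->]]; apply/commute_sym/commuteM.
      by apply/commuteX/commute_sym; have [] := Ccent d (mem_head _ _).
    apply/commute_sym/IHD => // e eD; apply: Ccent; exact: mem_behead.
  apply/allpairsP; exists (t', pi c * w); split=> //=.
    by apply: pspanM => //; exact: map_f.
  by rewrite -mulgA wcomm !mulgA /pi -!qpiM /c mulVKg.
have [t0 t0T _] := TP 1.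
have l0K : pi t0 \in K.
  apply/allpairsP; exists (t0, 1); split; rewrite ?mulg1 //.
  exact: pspan1.
(* The elements whose right translation, and that of their inverse, preserve the finite set [K] form
   a subgroup. It contains [s], hence is everything, and the orbit of [pi t0] fills the quotient
   without leaving [K]. *)
pose H := [set g | forall l, l \in K -> l * pi g \in K /\ l * pi g^-1 \in K].
have HT : gen [set` s] `<=` H.
  apply: gen_min.
    split=> [l lK|x y Hx Hy l lK|x Hx l lK] /=.
    - by rewrite invg1 /pi qpi1 mulg1.
    - rewrite invgM /pi !qpiM !mulgA; have [lx _] := Hx _ lK; have [_ ly] := Hy _ lK.
      by split; [have [] := Hy _ lx | have [] := Hx _ ly].
    - by rewrite invgK; have [] := Hx _ lK.
  move=> x /= xs l lK; split; apply: KM => //; rewrite mem_cat.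
    by rewrite xs.
  by apply/orP; right; apply: map_f.
apply/finite_seqP; exists K; apply/seteqP; split=> a //= _.
have [x ->] := qpi_surj a; have Hx : H (t0^-1 * x) by apply: HT; rewrite gens.
by have [] := Hx _ l0K; rewrite -qpiM mulVKg.
Qed.

(** * Homomorphisms to the integers and exponent sums *)

Section ExponentSums.

Section Hom.
Variables (G : groupType) (f : G -> int).
Hypothesis fM : forall x y, f (x * y) = (f x + f y)%R.

Lemma hom1 : f 1 = 0%R.
Proof. by have := fM 1 1; rewrite mulg1; lia. Qed.

Lemma homV x : f x^-1 = (- f x)%R.
Proof. by have := fM x x^-1; rewrite mulgV hom1; lia. Qed.

Lemma homX x n : f (x ^+ n) = (n%:Z * f x)%R.
Proof.
by elim: n => [|n IH]; rewrite ?expg0 ?hom1 ?mul0r // expgS fM IH; lia.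
Qed.

Lemma homJ x g : f (x ^ g) = f x.
Proof. by rewrite conjgE !fM homV; lia. Qed.

(** Commutators die in the abelian group of integers, so each step of the series is seen only
    through p-th powers, which contribute a factor [p]. *)
Lemma hom_lambda p k x : lambda G p k.+1 x -> ((p ^ k)%:Z %| f x)%Z.
Proof.
elim: k x => [|k IH] x; first by rewrite expn0 dvd1z.
apply: (@lambda_min _ _ _ [set x | ((p ^ k.+1)%:Z %| f x)%Z]).
- split=> [|y z|y] /=; rewrite ?hom1 ?dvdz0 // ?fM ?homV ?rpredN //.
  exact: rpredD.
- by move=> y g _ /=; rewrite commgEl fM homV homJ addNr dvdz0.
- by move=> y /IH Ly /=; rewrite homX expnS PoszM dvdz_mul.
Qed.

End Hom.

Definition expsum (T : choiceType) (t : T) (u : freeGroup T) : int :=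
  (\sum_(a <- word u) (if a.1 == t then (-1) ^+ a.2 else 0))%R.

(** A cancellation in [push] removes a letter and its inverse, whose contributions add up to
    zero. *)
Lemma expsumM (T : choiceType) (t : T) u v :
  expsum t (u * v) = (expsum t u + expsum t v)%R.
Proof.
rewrite /expsum; change (word (u * v)) with (word_mul u v).
elim: (word u) => [|a w IH] /=; first by rewrite big_nil add0r.
rewrite big_cons -addrA -IH; case: (word_mul w v) => [|b w'] /=.
  by rewrite big_cons.
case: eqP => [->|_]; last by rewrite !big_cons.
rewrite !big_cons addrA /letter_inv /=.
by case: (a.1 == t); case: a.2; rewrite /= ?addr0 ?add0r ?expr0 ?expr1 ?addNr ?subrr ?add0r.
Qed.

Lemma expsum_gen (T : choiceType) (t s : T) :
  expsum t (fg_gen s) = Posz (s == t).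
Proof. by rewrite /expsum big_seq1 /=; case: (s == t). Qed.

End ExponentSums.

(** * Generators of the free group and determinants of exponent sums *)

Lemma freeGroup_gen (T : choiceType) :
  gen (range (@fg_gen T)) = [set: freeGroup T].
Proof.
apply/seteqP; split=> // -[w rw] _.
have [g1 gM gV] := gen_subgroup (range (@fg_gen T)).
elim: w rw => [|[t b] w IH] rw.
  by rewrite (_ : FreeGroup rw = 1) //; apply: val_inj.
have rw' : reduced w := path_sorted rw.
have -> : FreeGroup rw = (if b then (fg_gen t)^-1 else fg_gen t) * FreeGroup rw'.
  apply: val_inj; case: b rw => /=; case: w {IH rw'} => [|c w] //= /andP[/negbTE ca _];
  by rewrite /letter_inv /= in ca *; rewrite ca.
apply: gM; last exact: IH.
by case: b {rw}; [apply: gV|]; apply: gen_sub; exists t.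
Qed.

Local Notation fx := (fg_gen ord0 : free2).
Local Notation fy := (fg_gen (lift ord0 ord0) : free2).
Local Notation ex := (@expsum 'I_2 ord0).
Local Notation ey := (@expsum 'I_2 (lift ord0 ord0)).

Lemma free2_gen : gen [set fx; fy] = [set: free2].
Proof.
apply/seteqP; split=> // u _; have: [set: free2] u by [].
rewrite -(freeGroup_gen 'I_2); apply: gen_subset => _ [i _ <-].
by case: (unliftP ord0 i) => [j ->|->]; [rewrite [j]ord1; right|left].
Qed.

(** The determinant of the images in the abelianization [Z^2]. It is divisible by [p] exactly when
    these images are linearly dependent modulo [p]. *)
Definition det2 (u v : free2) : int := (ex u * ey v - ey u * ex v)%R.

Lemma dvdz_det2l (d : int) u v :
  (d %| ex u)%Z -> (d %| ey u)%Z -> (d %| det2 u v)%Z.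
Proof. by move=> dx dy; apply: rpredB; exact: dvdz_mulr. Qed.

Lemma dvdz_det2r (d : int) u v :
  (d %| ex v)%Z -> (d %| ey v)%Z -> (d %| det2 u v)%Z.
Proof. by move=> dx dy; apply: rpredB; exact: dvdz_mull. Qed.

(** * Linear algebra modulo p in the free group of rank two *)

Section Free2.
Variable p : nat.
Hypothesis p_pr : prime p.
Local Notation L := (lambda free2 p).

(** The quotient by [lambda 2] is abelian of exponent [p], so [u] is congruent to some
    [fx ^+ i * fy ^+ j]. Its exponent sums are then [i] and [j] modulo [p], and both powers
    vanish. *)
Lemma lambda2P (u : free2) : (p%:Z %| ex u)%Z -> (p%:Z %| ey u)%Z -> L 2 u.
Proof.
pose N := lambda_nsg free2 p 2; pose pi := qpi N.
have comm (a b : quotient N) : commute a b.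
  have [v ->] := qpi_surj a; have [w ->] := qpi_surj b.
  by apply/commgP/eqP; rewrite -qpiR; apply/qpi_eq1/lambdaR.
have expp (a : quotient N) : a ^+ p = 1.
  by have [v ->] := qpi_surj a; rewrite -qpiX; apply/qpi_eq1/lambdaX.
have [i [j uE]] : exists i j, pi u = pi (fx ^+ i * fy ^+ j).
  have: gen [set fx; fy] u by rewrite free2_gen.
  apply: (@gen_min _ _ [set u | exists i j, pi u = pi (fx ^+ i * fy ^+ j)]).
    split=> [|v w [i [j vE]] [k [l wE]]|v [i [j vE]]] /=.
    - by exists 0%N, 0%N; rewrite !expg0 mulg1.
    - exists (i + k)%N, (j + l)%N.
      rewrite /pi qpiM -/pi vE wE /pi -qpiM !expgnDr !qpiM -!mulgA; congr (_ * _).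
      by rewrite !mulgA [X in X * _]comm.
    - exists (i * p.-1)%N, (j * p.-1)%N; apply: (mulgI (pi v)).
      rewrite -[LHS]qpiM mulgV qpi1 vE /pi !expgnA !qpiM !qpiX.
      rewrite -!expgMn //; try exact: comm.
      by rewrite -expgS prednK ?prime_gt0 // expp.
  by move=> v [->|->]; [exists 1%N, 0%N|exists 0%N, 1%N];
    rewrite expg0 expg1 ?mulg1 ?mul1g.
have Luv := (eq_qpi N _ _).1 uE.
have hx := hom_lambda (expsumM _) Luv : (_ %| ex _)%Z.
have hy := hom_lambda (expsumM _) Luv : (_ %| ey _)%Z.
move: hx hy.
rewrite !expsumM !(homV (expsumM _)) !(homX (expsumM _)) !expsum_gen /= expn1.
rewrite mulr1 !mulr0 !addr0 add0r mulr1 => hx hy pu pv.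
have /dvdnP[k ik] : (p %| i)%N by move: hx; rewrite rpredDl ?rpredN.
have /dvdnP[l jl] : (p %| j)%N by move: hy; rewrite rpredDl ?rpredN.
apply/(qpi_eq1 N); rewrite -/pi uE /pi qpiM !qpiX ik jl mulnC expgnA expp.
by rewrite mulnC expgnA expp !expg1n mulg1.
Qed.

Lemma euclidz (a b : int) : (p%:Z %| (a * b)%R)%Z = (p%:Z %| a)%Z || (p%:Z %| b)%Z.
Proof. by rewrite !dvdzE abszM Euclid_dvdM. Qed.

Lemma not_dvdz1 : (p%:Z %| 1)%Z = false.
Proof. by rewrite dvdzE /= dvdn1; case: eqP p_pr => // ->. Qed.

(** A Bezout coefficient inverts [c] modulo [p]; reducing its product with [d] modulo [p] makes the
    solution a natural number. *)
Lemma dvdz_solve (c d : int) :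
  ~~ (p%:Z %| c)%Z -> exists i : nat, (p%:Z %| (i%:Z * c - d)%R)%Z.
Proof.
move=> pc; have cop : coprimez p c.
  by rewrite coprimezE /= prime_coprime // -[p in (p %| _)%N]/(`|Posz p|%N) -dvdzE.
have [[m k] /= mk] := coprimezP _ _ cop.
exists `|((k * d) %% p%:Z)%Z|%N.
have p0 : Posz p != 0%R by rewrite eqz_nat -lt0n prime_gt0.
rewrite gez0_abs ?modz_ge0 //.
have E := divz_eq (k * d)%R p.
apply/dvdzP; exists (- (m * d) - ((k * d) %/ p%:Z)%Z * c)%R.
have -> : ((k * d) %% p%:Z)%Z = (k * d - ((k * d) %/ p%:Z)%Z * p%:Z)%R.
  by rewrite {2}E addrAC subrr add0r.
by rewrite -[X in (_ - X)%R = _]mulr1 -mk; ring.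
Qed.

(** One exponent sum of [b] is invertible modulo [p]. Solving for [i] there, the vanishing
    determinant forces the congruence for the other exponent sum. *)
Lemma parallel_lambda2 (a b : free2) :
  (p%:Z %| det2 a b)%Z -> ~~ ((p%:Z %| ex b) && (p%:Z %| ey b))%Z ->
  exists i, L 2 (a^-1 * b ^+ i).
Proof.
rewrite negb_and => /dvdzP[q dab] /orP[] pb.
  have [i hi] := dvdz_solve (ex a) pb; exists i.
  have hy : (p%:Z %| (ex b * (i%:Z * ey b - ey a))%R)%Z.
    have [r hr] := dvdzP hi; apply/dvdzP; exists (r * ey b + q)%R.
    move: dab; rewrite /det2 => dab.
    by rewrite mulrDl -dab -mulrA [(ey b * _)%R]mulrC mulrA -hr; ring.
  move: hy; rewrite euclidz (negbTE pb) /= => hy.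
  by apply: lambda2P; rewrite expsumM (homV (expsumM _)) (homX (expsumM _)) addrC.
have [i hi] := dvdz_solve (ey a) pb; exists i.
have hx : (p%:Z %| (ey b * (i%:Z * ex b - ex a))%R)%Z.
  have [r hr] := dvdzP hi; apply/dvdzP; exists (r * ex b - q)%R.
  move: dab; rewrite /det2 => dab.
  by rewrite mulrBl -dab -mulrA [(ex b * _)%R]mulrC mulrA -hr; ring.
move: hx; rewrite euclidz (negbTE pb) /= => hx.
by apply: lambda2P; rewrite expsumM (homV (expsumM _)) (homX (expsumM _)) addrC.
Qed.

(** * Generation and cyclic subgroups in the quotient by [lambda m.+2] *)

Variable m : nat.
Local Notation Q := (quotient (lambda_nsg free2 p m.+2)).
Local Notation pi := (qpi (lambda_nsg free2 p m.+2)).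

(** If the determinant vanished modulo [p], some nonzero linear form modulo [p] would kill both
    generators, and hence the whole group. *)
Lemma gen_not_dvd (u v : free2) :
  gen [set pi u; pi v] = [set: Q] -> ~~ (p%:Z %| det2 u v)%Z.
Proof.
move=> genuv; apply/negP => pdet.
(* The form is [det2 u] if [u] is nonzero modulo [p], else [det2 v] if [v] is nonzero, else the
   first coordinate. *)
have [[a b] /= [au av] ab] : exists2 ab : int * int,
    (p%:Z %| (ab.1 * ex u + ab.2 * ey u)%R)%Z /\
    (p%:Z %| (ab.1 * ex v + ab.2 * ey v)%R)%Z
    & ~~ ((p%:Z %| ab.1) && (p%:Z %| ab.2))%Z.
  have [pu|pu] := boolP ((p%:Z %| ex u) && (p%:Z %| ey u))%Z; last first.
    exists (- ey u, ex u)%R; last by rewrite !dvdzE /= abszN andbC.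
    split; last by rewrite (_ : _ + _ = det2 u v)%R // /det2 /=; ring.
    by rewrite (_ : _ + _ = 0)%R ?dvdz0 //=; ring.
  have [pv|pv] := boolP ((p%:Z %| ex v) && (p%:Z %| ey v))%Z; last first.
    exists (- ey v, ex v)%R; last by rewrite !dvdzE /= abszN andbC.
    split; last by rewrite (_ : _ + _ = 0)%R ?dvdz0 //=; ring.
    by rewrite (_ : _ + _ = - det2 u v)%R ?rpredN // /det2 /=; ring.
  exists (1, 0)%R; last by rewrite /= not_dvdz1.
  by rewrite /= !mul1r !mul0r !addr0; case/andP: pu => ->; case/andP: pv => ->.
pose phi w : int := (a * ex w + b * ey w)%R.
have phiM w w' : phi (w * w') = (phi w + phi w')%R.
  by rewrite /phi !expsumM; ring.
pose H := [set g : Q | exists2 w, g = pi w & (p%:Z %| phi w)%Z].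
have HT : gen [set pi u; pi v] `<=` H.
  apply: gen_min => [|_ [->|->]]; [|by exists u|by exists v].
  split=> [|_ _ [w -> pw] [w' -> pw']|_ [w -> pw]].
  - by exists 1; rewrite ?qpi1 // (hom1 phiM) dvdz0.
  - by exists (w * w'); rewrite ?qpiM // phiM rpredD.
  - by exists w^-1; rewrite ?qpiV // (homV phiM) rpredN.
(* Membership in [H] does not depend on the lift, because [phi] is divisible by [p] on
   [lambda m.+2]. *)
have Hphi w : (p%:Z %| phi w)%Z.
  have [w' /eq_qpi Lw pw'] : H (pi w) by apply: HT; rewrite genuv.
  have := hom_lambda phiM Lw; rewrite phiM (homV phiM) expnS PoszM => h.
  have {h} := dvdz_trans (dvdz_mulr _ (dvdzz _)) h.
  by rewrite rpredDr // rpredN.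
have := Hphi fx; have := Hphi fy; rewrite /phi !expsum_gen /=.
by rewrite !mulr0 !mulr1 addr0 add0r => pb pa; rewrite pa pb in ab.
Qed.

(** A single generator would give a generating pair with equal entries, whose determinant is
    zero. *)
Lemma min_generators_lambda : min_generators Q 2.
Proof.
split.
  exists [:: pi fx; pi fy]; split=> //.
  by rewrite set_seq2 -(gen_qpi _ free2_gen) image_setU !image_set1.
move=> s gens; rewrite leqNgt; apply/negP => s1.
have [g sg] : exists g, [set` s] `<=` [set g].
  case: s s1 {gens} => [|g [|//]] _; first by exists 1.
  by exists g => h /=; rewrite inE => /eqP.
have [u gu] := qpi_surj g; have /negP[] : ~~ (p%:Z %| det2 u u)%Z.
  apply: gen_not_dvd; apply/seteqP; split=> // a _.
  have: gen [set` s] a by rewrite gens.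
  by apply: gen_subset => h /sg ->; left.
by rewrite /det2 mulrC subrr dvdz0.
Qed.

Lemma parallel_expX (a b : free2) :
  (p%:Z %| det2 a b)%Z -> ~~ ((p%:Z %| ex b) && (p%:Z %| ey b))%Z ->
  exists i, pi (a ^+ (p ^ m)) = pi b ^+ i.
Proof.
move=> dab pb; have [i Lab] := parallel_lambda2 dab pb.
exists (i * p ^ m)%N; rewrite expgnA -!qpiX; apply/eq_qpi.
by have := lambda_congXX m Lab; rewrite addn1.
Qed.

(** The exponent sums are multiplied by [p ^ m] but must be divisible by [p ^ m.+1], which leaves
    one factor [p] for those of [a]. *)
Lemma pi_expX_eq1 (a : free2) : pi (a ^+ (p ^ m)) = 1 ->
  (p%:Z %| ex a)%Z /\ (p%:Z %| ey a)%Z.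
Proof.
move=> /qpi_eq1 La; have pm0 : Posz (p ^ m) != 0%R.
  by rewrite eqz_nat -lt0n expn_gt0 prime_gt0.
have hx := hom_lambda (expsumM _) La : (_ %| ex _)%Z.
have hy := hom_lambda (expsumM _) La : (_ %| ey _)%Z.
by split; [move: hx|move: hy]; rewrite (homX (expsumM _)) expnSr PoszM dvdz_mul2l.
Qed.

Lemma pi_expg (a : Q) : a ^+ (p ^ m.+1) = 1.
Proof.
have [u ->] := qpi_surj a; rewrite -qpiX; apply/qpi_eq1.
by have := @lambdaXX free2 p 0 m.+1 u; rewrite addn0; apply.
Qed.

Lemma mem_gen_pi (a : free2) g : gen [set pi a] g -> exists i, g = pi (a ^+ i).
Proof.
move=> ga; have [|i ->] := mem_gen1 _ (pi_expg _) ga.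
  by rewrite expn_gt0 prime_gt0.
by exists i; rewrite qpiX.
Qed.

(** Conjugation preserves exponent sums, so [i] times those of [a] agree with [j] times those of [b]
    modulo [p ^ m.+1]. Taking the determinant against [b] removes the second side; hence [p ^ m.+1]
    divides [i], and the power of [a] is trivial. *)
Lemma disjoint_cycles (a b : free2) (i j : nat) (g h : Q) :
  ~~ (p%:Z %| det2 a b)%Z ->
  pi (a ^+ i) ^ g = pi (b ^+ j) ^ h -> pi (a ^+ i) ^ g = 1.
Proof.
move=> dab; have [g' ->] := qpi_surj g; have [h' ->] := qpi_surj h.
rewrite -!qpiJ => /eq_qpi Lab.
have := hom_lambda (expsumM _) Lab : (_ %| ex _)%Z.
have := hom_lambda (expsumM _) Lab : (_ %| ey _)%Z.
rewrite !expsumM !(homV (expsumM _)) !(homJ (expsumM _)) !(homX (expsumM _)).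
move=> /dvdzP[s hs] /dvdzP[r hr].
have : ((p ^ m.+1)%:Z %| (i%:Z * det2 a b)%R)%Z.
  apply/dvdzP; exists (s * ex b - r * ey b)%R.
  move: (Posz (p ^ m.+1)) hs hr => P hs hr.
  have -> : ((s * ex b - r * ey b) * P = s * P * ex b - r * P * ey b)%R by ring.
  by rewrite -hs -hr /det2; ring.
rewrite Gauss_dvdzl; last by rewrite coprimezE [`|Posz _|%N]/= coprimeXl ?prime_coprime.
rewrite dvdzE /= => /dvdnP[k ->].
by rewrite mulnC expgnA qpiJ !qpiX pi_expg // expg1n conj1g.
Qed.

End Free2.

(** * The two directions of the equivalence *)

Lemma not_Beauville_trivial (G : groupType) :
  (forall a : G, a = 1) -> ~ Beauville G.
Proof.
move=> G1 [_ [_ min2] _]; suff /min2 : gen [set` [::]] = [set: G] by [].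
apply/seteqP; split=> // a _; rewrite (G1 a).
by have [] := gen_subgroup [set` [::] : seq G].
Qed.

(** For [p = 3] the residues are [1] or [-1], and opposite ones have sum zero. For [p = 2] the
    hypothesis is contradictory, as two odd numbers have an even sum. *)
Lemma dvdz_sub_le3 (p : nat) (s t : int) : prime p -> p <= 3 ->
  ~~ [|| (p %| s)%Z, (p %| t)%Z | (p %| (s + t)%R)%Z] -> (p %| (s - t)%R)%Z.
Proof. by case: p => [|[|[|[|p]]]] //; lia. Qed.

Section Main.
Variables (p m : nat).
Hypothesis p_pr : prime p.
Local Notation Q := (quotient (lambda_nsg free2 p m.+2)).
Local Notation pi := (qpi (lambda_nsg free2 p m.+2)).

(* Otherwise [dvdz_sub_le3] makes the forms [det2 u] and [det2 v] agree modulo [p] at both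
   [u'] and [v'], which contradicts the Pluecker relation. *)
Lemma exists_parallel (u v u' v' : free2) : p <= 3 ->
  ~~ (p%:Z %| det2 u v)%Z -> ~~ (p%:Z %| det2 u' v')%Z ->
  exists a b, [/\ a = u \/ a = v \/ a = u * v, b = u' \/ b = v'
                & (p%:Z %| det2 a b)%Z].
Proof.
move=> p3 duv duv'.
have [|] := boolP [|| (p%:Z %| det2 u u')%Z, (p%:Z %| det2 v u')%Z
                    | (p%:Z %| det2 (u * v) u')%Z].
  by move=> /or3P[] h; [exists u, u' | exists v, u' | exists (u * v), u'];
    split=> //; auto.
have [|] := boolP [|| (p%:Z %| det2 u v')%Z, (p%:Z %| det2 v v')%Z
                    | (p%:Z %| det2 (u * v) v')%Z].
  by move=> /or3P[] h; [exists u, v' | exists v, v' | exists (u * v), v'];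
    split=> //; auto.
have det2M w : det2 (u * v) w = (det2 u w + det2 v w)%R.
  by rewrite /det2 !expsumM; ring.
rewrite !det2M => h' h; exfalso; apply/negP: (duv); rewrite negbK.
have plucker : (det2 u u' * det2 v v' - det2 u v' * det2 v u' =
                det2 u v * det2 u' v')%R by rewrite /det2; ring.
have /dvdzP[k /eqP hk] := dvdz_sub_le3 p_pr p3 h.
have /dvdzP[l /eqP hl] := dvdz_sub_le3 p_pr p3 h'.
rewrite subr_eq in hk; rewrite subr_eq in hl.
have : (p%:Z %| (det2 u v * det2 u' v')%R)%Z.
  rewrite -plucker (eqP hk) (eqP hl); apply/dvdzP; exists (k * det2 v v' - l * det2 v u')%R.
  ring.
by rewrite euclidz // (negbTE duv') orbF.
Qed.

Lemma Beauville_ge5 : Beauville Q -> 5 <= p.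
Proof.
move=> [_ _ [x1 [y1 [x2 [y2 [gen1 gen2 disj]]]]]].
case: (leqP p 3) => [p3|]; last first.
  by move: p_pr; case: (p) => [|[|[|[|[|]]]]].
exfalso; move: gen1 gen2 disj.
have [u ->] := qpi_surj x1; have [v ->] := qpi_surj y1.
have [u' ->] := qpi_surj x2; have [v' ->] := qpi_surj y2.
move=> /(gen_not_dvd p_pr) d /(gen_not_dvd p_pr) d' disj.
have [a [b [a_eq b_eq dab]]] := exists_parallel p3 d d'.
have b0 : ~~ ((p%:Z %| ex b) && (p%:Z %| ey b))%Z.
  apply: contra d' => /andP[bx by_].
  by case: b_eq bx by_ => -> bx by_; [apply: dvdz_det2l|apply: dvdz_det2r].
have [i abi] := parallel_expX p_pr m dab b0.
(* [pi (a ^+ (p ^ m))] lies in both sets [Sigma], so it is trivial and [a] vanishes modulo [p]. *)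
have /(pi_expX_eq1 p_pr) [ax ay] : [set 1] (pi (a ^+ (p ^ m))).
  rewrite -disj; split; apply/SigmaP.
    exists (pi a), 1, (pi (a ^+ (p ^ m))); rewrite conjg1 -qpiM; split=> //.
      by case: a_eq => [->|[->|->]]; auto.
    by rewrite qpiX; apply: genX; exact: gen_sub.
  exists (pi b), 1, (pi (a ^+ (p ^ m))); rewrite conjg1; split=> //.
    by case: b_eq => ->; auto.
  by rewrite abi; apply: genX; exact: gen_sub.
have : (p%:Z %| det2 u v)%Z.
  case: a_eq ax ay => [->|[->|->]] ax ay; [exact: dvdz_det2l|exact: dvdz_det2r|].
  (* Adding the second row to the first leaves the determinant unchanged. *)
  rewrite (_ : det2 u v = det2 (u * v) v); first exact: dvdz_det2l.
  by rewrite /det2 !expsumM; ring.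
by rewrite (negbTE d).
Qed.

(* The slopes are [oo, 0, 1] against [2, 3, 4]: the exponent [-2] in [v] is chosen so that
   [(1, 2) - 2 (1, 3) = - (1, 4)], and all nine determinants divide [12]. *)
Lemma Beauville_lambda : 5 <= p -> Beauville Q.
Proof.
move=> p5; pose u := fx * fy ^+ 2; pose w := fx * fy ^+ 3; pose v := (w ^+ 2)^-1.
split.
- apply: (@lambda_finite _ [:: fx; fy]); first exact: prime_gt0.
  by rewrite set_seq2 free2_gen.
- exact: min_generators_lambda.
exists (pi fx), (pi fy), (pi u), (pi v); split.
- by rewrite -(gen_qpi _ free2_gen) image_setU !image_set1.
- have [g1 gM gV] := gen_subgroup [set pi u; pi v].
  have gu : gen [set pi u; pi v] (pi u) by apply: gen_sub; left.
  have gv : gen [set pi u; pi v] (pi v) by apply: gen_sub; right.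
  have gw : gen [set pi u; pi v] (pi w).
    (* Squaring is invertible on powers of [pi w], whose order divides the odd number [p ^ m.+1]:
       half of [p ^ m.+1 + 1] inverts 2. *)
    have [k ->] : exists k, pi w = pi (w ^+ 2) ^+ k.
      have p_odd : odd (p ^ m.+1) by rewrite oddX; case: (even_prime p_pr) p5 => [->|->].
      exists ((p ^ m.+1).+1./2)%N; rewrite qpiX -expgnA mul2n.
      rewrite (_ : (_./2).*2 = (p ^ m.+1).+1)%N; last by move: p_odd; lia.
      by rewrite expgSr pi_expg // mul1g.
    apply: genX; have -> : pi (w ^+ 2) = (pi v)^-1 by rewrite /v qpiV invgK.
    exact: gV.
  have gy : gen [set pi u; pi v] (pi fy).
    have -> : pi fy = (pi u)^-1 * pi w.
      have -> : w = u * fy by rewrite /w /u expgSr mulgA.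
      by rewrite -qpiV -qpiM mulKg.
    by apply: gM => //; exact: gV.
  have gx : gen [set pi u; pi v] (pi fx).
    have -> : pi fx = pi u * (pi fy ^+ 2)^-1 by rewrite -qpiX -qpiV -qpiM mulgK.
    by apply: gM => //; apply: gV; exact: genX.
  apply/seteqP; split=> // a _.
  have : gen (pi @` [set fx; fy]) a by rewrite (gen_qpi _ free2_gen).
  apply: gen_min; first exact: gen_subgroup.
  by move=> _ [z [->|->] <-].
apply/seteqP; split=> [g|_ ->]; last by split; exact: Sigma1.
case=> /SigmaP[a0 [h [z [a_eq az ->]]]] /SigmaP[b0 [h' [z' [b_eq bz' zz']]]].
have [a a_eq' aE] : exists2 a, a = fx \/ a = fy \/ a = fx * fy & a0 = pi a.
  by case: a_eq => [->|[->|->]]; [exists fx|exists fy|exists (fx * fy)];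
    rewrite ?qpiM; auto.
have [b b_eq' bE] : exists2 b, b = u \/ b = v \/ b = u * v & b0 = pi b.
  by case: b_eq => [->|[->|->]]; [exists u|exists v|exists (u * v)];
    rewrite ?qpiM; auto.
rewrite aE in az; rewrite bE in bz'.
have [i zE] := mem_gen_pi p_pr az; have [j z'E] := mem_gen_pi p_pr bz'.
rewrite zE; apply: (@disjoint_cycles _ p_pr _ _ b _ j _ h'); last by rewrite -zE zz' z'E.
have eu : ex u = 1%R /\ ey u = 2%:Z%R.
  by rewrite /u !expsumM !expsum_gen.
have ev : ex v = (-2)%R /\ ey v = (-6)%R.
  by rewrite /v /w !(homV (expsumM _)) !expsumM !expsum_gen.
have small k : k %| 12 -> ~~ (p %| k)%N.
  move=> k12; apply/negP => /dvdn_trans /(_ k12); rewrite (_ : 12 = 2 ^ 2 * 3)%N //.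
  rewrite Euclid_dvdM // Euclid_dvdX // !dvdn_prime2 //.
  by case: eqP p5 => [->|_] //; case: eqP => // ->.
have [[eux euy] [evx evy]] := (eu, ev).
(* With [u] and [v] opaque, the nine determinants are computed from exponent sums alone. *)
clear - a_eq' b_eq' eux euy evx evy small; clearbody u v.
case: a_eq' => [->|[->|->]]; case: b_eq' => [->|[->|->]];
  by rewrite /det2 ?expsumM ?expsum_gen ?eux ?euy ?evx ?evy dvdzE; apply: small.
Qed.

End Main.

End Lemmas.

Theorem theoremA (p n : nat) (hp : prime p) (hn : 1 <= n) :
  Beauville (quotient (lambda_nsg free2 p n)) <-> (5 <= p) /\ (2 <= n).
Proof.
case: n hn => [//|[|m]] _; last first.
  by split=> [/(Beauville_ge5 hp)|[/(Beauville_lambda m hp)]].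
(* For [n = 1] the subgroup [lambda 1] is the whole group, so the quotient is trivial. *)
split=> [|[_ //]].
have /not_Beauville_trivial // : forall a : quotient (lambda_nsg free2 p 1), a = 1%g.
by move=> a; have [x ->] := qpi_surj a; apply/qpi_eq1.
Qed.
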